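(* Let $n$ be a positive integer, and let $x_1,\ldots,x_n,y_1,\ldots,y_n$ be elements of a commutative ring with identity. Then $$\left|(x_i+y_j)^n\right|_{1\le i,j\le n}=(-1)^{n(n-1)/2}\prod_{1\le i<j\le n}(x_j-x_i)(y_j-y_i)\times\sum_{k=0}^n\Bigg(\prod_{r\in\{0,\ldots,n\}\setminus\{k\}}\binom nr\Bigg)\sigma_k(x_1,\ldots,x_n)\,\sigma_{n-k}(y_1,\ldots,y_n).$$
   Context: For a square matrix $[a_{ij}]_{1\le i,j\le n}$, $|a_{ij}|_{1\le i,j\le n}$ denotes its determinant. For $k=1,\ldots,n$, $\sigma_k(x_1,\ldots,x_n)=\sum_{1\le i_1<\cdots<i_k\le n}\prod_{j=1}^k x_{i_j}$ is the $k$th elementary symmetric polynomial, and $\sigma_0(x_1,\ldots,x_n)=1$. *)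

(* Defs.v *)
From mathcomp Require Import all_boot all_algebra.

Set Implicit Arguments.
Unset Strict Implicit.
Unset Printing Implicit Defensive.

Import GRing.Theory.
Local Open Scope ring_scope.

(* Index tuples i_1 < ... < i_k are encoded as the k-element subsets of 'I_n;
   for k = 0 the only subset is empty, so sigma 0 x = 1.  The ring may be the
   zero ring, which rules out multinomials' mesym. *)
Definition sigma (R : comPzRingType) (n k : nat) (x : 'I_n -> R) : R :=
  \sum_(A : {set 'I_n} | #|A| == k) \prod_(i in A) x i.

(* Main.v *)
(** Since [x_i] is a root of [\prod_j ('X - x_j)], the power [x_i ^+ n] is a
    combination of [1, ..., x_i ^+ (n - 1)] whose coefficients are signed
    elementary symmetric polynomials; likewise for [y_j].  Substituting this in
    the two extreme terms of the binomial expansion of [(x_i + y_j) ^+ n]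
    factors the matrix as [V(x)^T *m N *m Y], where [Y] is the Vandermonde
    matrix of [y] with its rows reversed and [N] is a diagonal matrix of
    binomial coefficients bordered by one row and one column.  The determinant
    of [N] is the sum over [k]: its corner contributes the terms [k = 0] and
    [k = n], its border the others. *)
Require Import Defs.
From mathcomp Require Import all_boot all_fingroup all_algebra ring zify.

Set Implicit Arguments.
Unset Strict Implicit.
Unset Printing Implicit Defensive.

Import GRing.Theory.
Local Open Scope ring_scope.

Lemma prod_neq_lift (R : comPzRingType) (n : nat) (j : 'I_n) (F : 'I_n -> R) :
  \prod_(r | r != j) F r = \prod_i F (lift j i).
Proof.
rewrite (reindex_omap (lift j) (unlift j)) => [|i].
  by under eq_bigl do rewrite liftK eq_sym eqxx neq_lift.
by case: unliftP => [k ->|->]; rewrite ?eqxx.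
Qed.

(** Laplace expansion along the row [ord0]. The corner [e] leaves a diagonal minor; [p j] leaves a
    minor that is expanded once more, along its row [j], and the two cofactor signs multiply to
    minus the sign of the corner. *)
Lemma det_bordered (R : comPzRingType) (m : nat) (e : R) (p q d : 'I_m -> R) :
  \det (\matrix_(i < m.+1, j < m.+1)
          match unlift ord0 i, unlift ord_max j with
          | None, None => e
          | None, Some b => p b
          | Some a, None => q a
          | Some a, Some b => d a *+ (a == b)
          end) =
    (-1) ^+ m * (e * \prod_i d i - \sum_i p i * q i * \prod_(r | r != i) d r).
Proof.
set N := \matrix_(i, j) _.
have N00 : N ord0 ord_max = e by rewrite mxE !unlift_none.
have N0l b : N ord0 (lift ord_max b) = p b by rewrite mxE unlift_none liftK.
have Nl0 a : N (lift ord0 a) ord_max = q a by rewrite mxE unlift_none liftK.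
have Nll a b : N (lift ord0 a) (lift ord_max b) = d a *+ (a == b).
  by rewrite mxE !liftK.
rewrite (expand_det_row N ord0) (bigD1_ord ord_max) //= N00 mulrBr.
congr (_ + _).
  rewrite /cofactor add0n mulrCA; congr (_ * (_ * _)).
  transitivity (\det (diag_mx (\row_i d i))); last first.
    by rewrite det_diag; apply: eq_bigr => i _; rewrite mxE.
  by congr (\det _); apply/matrixP => a b; rewrite !mxE /= !liftK.
rewrite mulr_sumr -sumrN; apply: eq_bigr => j _; rewrite N0l /cofactor add0n.
case: m => [|m] in e p q d N N00 N0l Nl0 Nll j *; first by case: j.
have liftjm : lift (lift ord_max j) ord_max = ord_max :> 'I_m.+2.
  by apply: val_inj => /=; rewrite /bump; have := ltn_ord j; lia.
have liftjl k : lift (lift ord_max j) (lift ord_max k)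
                  = lift ord_max (lift j k) :> 'I_m.+2.
  apply: val_inj => /=; rewrite /bump.
  by have := ltn_ord j; have := ltn_ord k; lia.
(* The diagonal entry [d j] of this row lay in the deleted column, so only [q j], in the last
   column, survives. *)
rewrite (expand_det_row _ j) (bigD1_ord ord_max) //= big1 => [|k _]; last first.
  rewrite [X in X * _](_ : _ = 0) ?mul0r //.
  by rewrite 2![in LHS]mxE liftjl Nll (negPf (neq_lift _ _)).
rewrite 2![in X in X * cofactor _ _ _]mxE liftjm Nl0 addr0 /cofactor.
rewrite [\det _](_ : _ = \prod_(r | r != j) d r); last first.
  transitivity (\det (diag_mx (\row_i d (lift j i)))); last first.
    by rewrite det_diag prod_neq_lift; apply: eq_bigr => i _; rewrite mxE.
  congr (\det _); apply/matrixP => a b.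
  rewrite 4![in LHS]mxE liftjl Nll !mxE.
  by rewrite (inj_eq lift_inj).
rewrite /= /bump leqNgt ltn_ord add0n exprD exprS.
(* A factor [(-1) ^+ j] is inserted twice, since [ring] does not know that its square is 1. *)
rewrite mulN1r mulNr opprK -{2}(signrMK j ((-1) ^+ m)).
by move: (\prod_(r | _) _) => P; ring.
Qed.

Lemma sigma0 (R : comPzRingType) (n : nat) (x : 'I_n -> R) : sigma 0 x = 1.
Proof.
rewrite /sigma (big_pred1 set0) => [|A]; last by rewrite cards_eq0.
by rewrite big_set0.
Qed.

(** Vieta's formula: distribute the product, [A] being the set of factors that contribute [- x i],
    and group by the cardinality of [A]. *)
Lemma prod_subr_sigma (R : comPzRingType) (n : nat) (x : 'I_n -> R) (z : R) :
  \prod_i (z - x i) = \sum_(k < n.+1) (-1) ^+ k * sigma k x * z ^+ (n - k).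
Proof.
rewrite (eq_bigr (fun i => - x i + z)) => [|i _]; last by rewrite addrC.
rewrite bigA_distr.
rewrite (partition_big (fun A : {set 'I_n} => inord #|A| : 'I_n.+1) xpredT) //=.
apply: eq_bigr => k _; rewrite /sigma mulr_sumr mulr_suml.
have cardE (A : {set 'I_n}) : (inord #|A| == k) = (#|A| == k).
  rewrite -val_eqE /= inordK // ltnS.
  by rewrite -[n in (_ <= n)%N]card_ord max_card.
apply: eq_big => [A|A]; rewrite ?cardE // => /eqP cA.
rewrite (bigID (mem A)) /=; congr (_ * _).
  rewrite -cA -prodrN; apply: eq_bigr => i iA; by rewrite iA.
rewrite (eq_bigr (fun=> z)) => [|i /negPf->//].
rewrite prodr_const; congr (_ ^+ _).
by rewrite -cA -[n in (n - _)%N]card_ord -(cardC (mem A)) addKn.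
Qed.

(** Vieta's formula at the root [z = x i], solved for the top power. The constant term stands apart
    because it goes to the corner of [N], the other terms to its border. *)
Lemma root_expr_sigma (R : comPzRingType) (m : nat) (x : 'I_m.+1 -> R)
    (i : 'I_m.+1) :
  x i ^+ m.+1 =
    (-1) ^+ m * sigma m.+1 x
    + \sum_(j < m) (-1) ^+ j * sigma j.+1 x * x i ^+ (m - j).
Proof.
have := prod_subr_sigma x (x i).
rewrite (bigD1 i) //= subrr mul0r big_ord_recl big_ord_recr /=.
rewrite sigma0 subnn subn0 expr0 !mul1r mulr1 => /esym/eqP.
rewrite addr_eq0 => /eqP->.
rewrite opprD addrC; congr (_ + _); first by rewrite /bump /= exprS; ring.
by rewrite -sumrN; apply: eq_bigr => j _; rewrite /bump /= subSS exprS; ring.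
Qed.

(** Each [j] has exactly [j] smaller indices, so the exponents add up to a binomial coefficient.
    This spreads the global sign over the pairs. *)
Lemma prod_ltn_sign (R : comPzRingType) (n : nat) :
  \prod_(i < n) \prod_(j < n | (i < j)%N) (-1 : R) = (-1) ^+ ((n * (n - 1)) %/ 2).
Proof.
rewrite (exchange_big_dep xpredT) //=.
rewrite (eq_bigr (fun j : 'I_n => (-1) ^+ j)) => [|j _]; last first.
  by rewrite (big_ord_narrow (ltnW (ltn_ord j))) prodr_const card_ord.
by rewrite prodrXr -(big_mkord xpredT id) bin2_sum bin2 divn2 subn1.
Qed.

(* Reversing the rows and reversing the columns of a square matrix have the
   same sign, and the latter only permutes the Vandermonde nodes. *)
Lemma det_Vandermonde_rev (R : comPzRingType) (n : nat) (y : 'I_n -> R) :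
  \det (\matrix_(i < n, j < n) y j ^+ (n - i.+1)) =
    (-1) ^+ ((n * (n - 1)) %/ 2)
    * \prod_(i < n) \prod_(j < n | (i < j)%N) (y j - y i).
Proof.
pose s := perm (@rev_ord_inj n).
pose V := Vandermonde n (\row_j y j).
have -> : \matrix_(i < n, j < n) y j ^+ (n - i.+1) = row_perm s V.
  by apply/matrixP => i j; rewrite !mxE permE.
have -> : \det (row_perm s V) = \det (col_perm s V).
  by rewrite row_permE col_permE !det_mulmx !det_perm odd_permV mulrC.
have -> : col_perm s V = Vandermonde n (\row_j y (rev_ord j)).
  by apply/matrixP => i j; rewrite !mxE permE.
(* Reversing both indices turns each factor [y j - y i] into its opposite, which uses up one -1 per
   pair. *)
rewrite det_Vandermonde -prod_ltn_sign (reindex_inj rev_ord_inj) /=.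
under eq_bigr => i _ do rewrite (reindex_inj rev_ord_inj) /=.
rewrite (exchange_big_dep xpredT) //= -big_split.
apply: eq_bigr => i _; rewrite -big_split /=.
apply: eq_big => [j|j _]; first by have := ltn_ord i; have := ltn_ord j; lia.
by rewrite !mxE !rev_ordK mulN1r opprB.
Qed.

Theorem theorem3p1 (R : comPzRingType) (n : nat) (n_gt0 : (0 < n)%N)
    (x y : 'I_n -> R) :
  \det (\matrix_(i < n, j < n) (x i + y j) ^+ n) =
    (-1) ^+ ((n * (n - 1)) %/ 2)
    * (\prod_(i < n) \prod_(j < n | (i < j)%N) ((x j - x i) * (y j - y i)))
    * \sum_(k < n.+1)
        (\prod_(r < n.+1 | r != k) ('C(n, r))%:R) * sigma k x * sigma (n - k) y.
Proof.
case: n => [//|m] in n_gt0 x y *.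
(* Coefficients of the reduced expansion: [e] of the constant, [p j] of [y ^+ (m - j)], [q j] of
   [x ^+ j.+1], and [d j] of the mixed monomial [x ^+ j.+1 * y ^+ (m - j)]. *)
pose e : R := (-1) ^+ m * (sigma m.+1 x + sigma m.+1 y).
pose p (j : 'I_m) : R := (-1) ^+ j * sigma j.+1 y.
pose q (j : 'I_m) : R := (-1) ^+ (m - j.+1) * sigma (m - j) x.
pose d (j : 'I_m) : R := ('C(m.+1, j.+1))%:R.
pose N := \matrix_(i < m.+1, j < m.+1)
  match unlift ord0 i, unlift ord_max j with
  | None, None => e
  | None, Some b => p b
  | Some a, None => q a
  | Some a, Some b => d a *+ (a == b)
  end.
pose Y := \matrix_(i < m.+1, j < m.+1) y j ^+ (m.+1 - i.+1).
have -> : \matrix_(i < m.+1, j < m.+1) (x i + y j) ^+ m.+1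
            = (Vandermonde m.+1 (\row_i x i))^T *m (N *m Y).
  apply/matrixP => i j; rewrite [LHS]mxE [RHS]mxE.
  rewrite (bigD1_ord ord0) //= [in RHS]mxE [(N *m Y) ord0 j]mxE.
  rewrite (bigD1_ord ord_max) //=.
  rewrite [N ord0 _]mxE !unlift_none ![Vandermonde _ _ _ _]mxE expr0 mul1r.
  rewrite [Y ord_max _]mxE subnn expr0 mulr1.
  have rowN a : (N *m Y) (lift ord0 a) j = q a + d a * y j ^+ (m - a).
    rewrite mxE (bigD1_ord ord_max) //= (bigD1 a) //= big1 => [|b /negPf ba].
      by rewrite !mxE !liftK unlift_none eqxx subnn expr0 mulr1 lift_max subSS addr0.
    by rewrite mxE !liftK eq_sym ba mul0r.
  rewrite [X in _ = _ + X](eq_bigr (fun a =>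
      q a * x i ^+ a.+1 + y j ^+ (m - a) * x i ^+ a.+1 *+ 'C(m.+1, a.+1)));
      last first.
    by move=> a _; rewrite rowN !mxE -mulr_natl -/(d a) /=; ring.
  rewrite big_split /=.
  rewrite [X in _ = _ + X + _](eq_bigr (fun b : 'I_m => p b * y j ^+ (m - b)));
    last by move=> b _; rewrite !mxE unlift_none liftK lift_max subSS.
  rewrite [x i + y j]addrC exprDn big_ord_recl big_ord_recr /=.
  rewrite bin0 binn subn0 subnn !expr0 mulr1 mul1r !mulr1n !root_expr_sigma.
  (* The expansion of [x i ^+ m.+1] lists descending powers, while [q] is indexed by ascending
     ones. *)
  rewrite [in X in _ + (_ + (_ + X))](reindex_inj rev_ord_inj) /=.
  have -> : \sum_(a < m) q a * x i ^+ a.+1 = \sum_(k < m)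
      (-1) ^+ (m - k.+1) * sigma (m - k.+1).+1 x * x i ^+ (m - (m - k.+1)).
    by apply: eq_bigr => k _; rewrite subKn // subnSK.
  have -> : \sum_(a < m) y j ^+ (m - a) * x i ^+ a.+1 *+ 'C(m.+1, a.+1) =
      \sum_(k < m) y j ^+ (m.+1 - bump 0 k) * x i ^+ bump 0 k
                    *+ 'C(m.+1, bump 0 k) by [].
  by rewrite /e /p; ring.
rewrite !det_mulmx det_tr det_Vandermonde det_bordered det_Vandermonde_rev.
rewrite [LHS]mulrCA [LHS]mulrC [X in X * _ = _]mulrCA.
congr (_ * _ * _).
  rewrite -big_split; apply: eq_bigr => i _; rewrite -big_split.
  by apply: eq_bigr => j _; rewrite !mxE.
(* Isolate [k = 0] and [k = n]: both extreme binomials equal 1, so either product reduces to that of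
   all [d i]. *)
rewrite big_ord_recl big_ord_recr !prod_neq_lift.
have -> : \prod_(i < m.+1) ('C(m.+1, lift ord0 i))%:R = \prod_i d i.
  by rewrite big_ord_recr /= binn mulr1.
have -> : \prod_(i < m.+1) ('C(m.+1, lift ord_max i))%:R = \prod_i d i.
  rewrite big_ord_recl bin0 mul1r.
  by apply: eq_bigr => i _; rewrite lift_max.
(* Border term [i] carries [sigma (m - i) x], so it matches [k = m - i]; the symmetry of binomial
   coefficients absorbs this reversal. *)
have dD (k : 'I_m) : \prod_(r < m.+2 | r != lift ord0 (widen_ord (leqnSn m) k))
    ('C(m.+1, r))%:R = \prod_(r | r != rev_ord k) d r.
  rewrite big_mkcond big_ord_recl big_ord_recr -big_mkcond /= bin0 mul1r.
  rewrite binn if_same mulr1 (reindex_inj rev_ord_inj) /=.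
  apply: eq_big => [r|r _]; last first.
    rewrite /d /= -bin_sub; [congr (_%:R); congr 'C(_, _)|];
      by have := ltn_ord r; rewrite /bump /=; lia.
  congr (~~ _); apply/eqP/eqP => [/lift_inj/(congr1 val)/= rk|->].
    by apply: val_inj; rewrite /= -rk; have := ltn_ord r; lia.
  by rewrite rev_ordK.
rewrite /= [X in _ = _ + (X + _)](_ : _ =
    - ((-1) ^+ m * \sum_i p i * q i * \prod_(r | r != i) d r)).
  rewrite /bump !add1n subnn subn0 !sigma0 /e mulrBr.
  by rewrite !mulrA -expr2 sqrr_sign; ring.
rewrite mulr_sumr -sumrN (reindex_inj rev_ord_inj); apply: eq_bigr => k _.
(* The exponents add up to [2 * m - 1], which is odd. *)
have sgn : (-1) ^+ m * ((-1) ^+ k * (-1) ^+ (m - k.+1)) = -1 :> R.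
  rewrite -!exprD -signr_odd.
  suff -> : odd (m + (k + (m - k.+1))) by [].
  by have := ltn_ord k; lia.
have km : (bump 0 (rev_ord k) = m - k)%N.
  by rewrite /= /bump; have := ltn_ord k; lia.
have -> : sigma (m.+1 - lift ord0 (widen_ord (leqnSn m) (rev_ord k))) y
    = sigma k.+1 y.
  by congr sigma; rewrite /= km; have := ltn_ord k; lia.
rewrite dD rev_ordK /= km /p /q.
move: (\prod_(r | _) _) => P.
transitivity (- ((-1) ^+ m * ((-1) ^+ k * (-1) ^+ (m - k.+1))
                 * (P * sigma (m - k) x * sigma k.+1 y))); last by ring.
by rewrite sgn mulN1r opprK.
Qed.
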